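(* Let $X$ be a real Hausdorff locally convex space, $T$ a topological space, $f_t:X\to\overline{\mathbb{R}}$ ($t\in T$) proper lower semicontinuous convex functions, and $f:=\sup_{t\in T}f_t$. Let $x\in X$ be such that for some $\varepsilon_0>0$: (i) the set $T_{\varepsilon_0}(x)$ is compact; (ii) for every $z\in\operatorname{dom}f$, the function $t\mapsto f_t(z)$ is upper semicontinuous on $T_{\varepsilon_0}(x)$. Then $$\partial f(x)=\bigcap_{L\in\mathcal{F}(x)}\overline{\operatorname{co}}\Big\{\bigcup_{t\in T(x)}\partial(f_t+\mathrm{I}_{L\cap\operatorname{dom}f})(x)\Big\},$$ where $\mathcal{F}(x)$ is the family of finite-dimensional linear subspaces $L$ of $X$ such that $x\in L$.
   Context: $\overline{\mathbb{R}}=\mathbb{R}\cup\{\pm\infty\}$, with the convention $(+\infty)+(-\infty)=(-\infty)+(+\infty)=+\infty$. $X^*$ is the topological dual of $X$, endowed with the weak*-topology, and $\langle\cdot,\cdot\rangle$ is the canonical pairing. For a convex $\varphi:X\to\overline{\mathbb{R}}$: $\operatorname{dom}\varphi=\{x\in X:\varphi(x)<+\infty\}$; $\varphi$ is proper if $\operatorname{dom}\varphi\neq\emptyset$ and $\varphi$ never takes the value $-\infty$; the subdifferential is $\partial\varphi(x)=\{x^*\in X^*:\varphi(y)-\varphi(x)\ge\langle x^*,y-x\rangle\ \forall y\in X\}$ if $\varphi(x)\in\mathbb{R}$, and $\partial\varphi(x)=\emptyset$ if $\varphi(x)\notin\mathbb{R}$. $\mathrm{I}_A$ is the indicator function of $A$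 ($0$ on $A$, $+\infty$ off $A$). $\overline{\operatorname{co}}$ is the closed convex hull (weak*-closed for subsets of $X^*$). Active index sets: $T_\varepsilon(x)=\{t\in T: f_t(x)\ge f(x)-\varepsilon\}$ for $\varepsilon\ge0$, and $T(x)=\{t\in T: f_t(x)=f(x)\}$. *)

(* Defs.v *)
From HB Require Import structures.
From mathcomp Require Import all_boot all_order all_algebra.
From mathcomp Require Import all_classical all_reals all_analysis.

Set Implicit Arguments.
Unset Strict Implicit.
Unset Printing Implicit Defensive.

Import Order.TTheory GRing.Theory Num.Theory.
Import numFieldNormedType.Exports.

Local Open Scope classical_set_scope.
Local Open Scope ring_scope.

Section dual_space.
Context {R : realType} (X : tvsType R).

Definition continuous_linear : {pred X -> R^o} :=
  mem [set h : X -> R^o | linear h /\ continuous h].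

Lemma continuous_linear_submod_closed : submod_closed continuous_linear.
Proof.
split=> [|a g h].
  rewrite inE; split=> [a u v|]; last exact: cst_continuous.
  by rewrite [RHS]addr0 scaler0.
rewrite !inE => -[lg cg] [lh ch]; split=> [b u v|u].
  rewrite [LHS]/(a *: g (b *: u + v) + h (b *: u + v)) lg lh.
  rewrite -[(a *: g + h) u]/(a *: g u + h u).
  rewrite -[(a *: g + h) v]/(a *: g v + h v).
  by rewrite !scalerDr !scalerA [b * a]mulrC addrACA.
by apply: cvgD; [apply: cvgZr; exact: cg|exact: ch].
Qed.

HB.instance Definition _ := GRing.isSubmodClosed.Build R (X -> R^o)
  continuous_linear continuous_linear_submod_closed.

Record dual := Dual {
  dual_val :> X -> R^o ;
  dual_valP : dual_val \in continuous_linear }.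

HB.instance Definition _ := [isSub for dual_val].
HB.instance Definition _ := [Choice of dual by <:].
HB.instance Definition _ := [SubChoice_isSubLmodule of dual by <:].

(* The weak* topology: the coarsest one making all the evaluations
   [fun xs => xs y] continuous. *)
HB.instance Definition _ := Topological.copy dual
  (initial_topology (dual_val : dual -> {ptws X -> R^o})).

End dual_space.

Arguments continuous_linear {R} X.

Definition closed_convex_hull {R : realType} {X : tvsType R}
    (A : set (dual X)) : set (dual X) :=
  smallest [set C | closed C /\ convex_set C] A.

Section convex_analysis.
Context {R : realType} {X : tvsType R}.
Implicit Types (phi : X -> \bar R) (x : X).
Local Open Scope ereal_scope.

Definition effdom phi : set X := [set y | phi y < +oo].

Definition proper_efun phi := effdom phi !=set0 /\ forall y, phi y != -oo.

(* [%dE] is the addition for which +oo + -oo = -oo + +oo = +oo. *)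
Definition convex_efun phi := forall (y z : X) (l : R), (0 < l < 1)%R ->
  phi (l *: y + (1 - l) *: z)%R <= (l%:E * phi y + (1 - l)%:E * phi z)%dE.

Definition subdifferential phi x : set (dual X) :=
  [set xs | phi x \is a fin_num /\
            forall y, (xs (y - x)%R)%:E <= phi y - phi x].

Definition indicator_efun (A : set X) (y : X) : \bar R :=
  if y \in A then 0 else +oo.

Definition finite_dim_subspace (L : set X) := exists (n : nat) (e : 'I_n -> X),
  L = range (fun c : 'I_n -> R => (\sum_i c i *: e i)%R).

End convex_analysis.

Section supremum.
Context {R : realType} {X T : Type}.
Implicit Types (f : T -> X -> \bar R) (x : X).
Local Open Scope ereal_scope.

Definition sup_efun f x : \bar R := ereal_sup (range (fun t => f t x)).

Definition eps_active f x (e : R) : set T :=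
  [set t | sup_efun f x - e%:E <= f t x].

Definition active f x : set T := [set t | f t x = sup_efun f x].

End supremum.

(* Upper semicontinuity of the restriction of g to A. *)
Definition upper_semicontinuous_on {R : realType} {T : topologicalType}
    (A : set T) (g : T -> \bar R) :=
  forall t a, A t -> (g t < a%:E)%E ->
    \forall s \near within A (nbhs t), (g s < a%:E)%E.

(* Main.v *)
Require Import Defs.
From HB Require Import structures.
From mathcomp Require Import all_boot all_order all_algebra.
From mathcomp Require Import all_classical all_reals all_analysis.
From mathcomp Require Import ring lra.
Import Order.TTheory GRing.Theory Num.Theory.
Import numFieldNormedType.Exports.
Import DualAddTheory.
Local Open Scope classical_set_scope.
Local Open Scope ring_scope.
Set Implicit Arguments.
Unset Strict Implicit.

(** Write F for the supremum of the f t.  That the right-hand side is contained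
    in the subdifferential of F at x is a direct check: for a fixed y, the
    inequality u (y - x) <= F y - F x cuts out a weak*-closed convex set of
    functionals u, and if L contains x and y, every subgradient of an active
    f t restricted to L and to dom F satisfies it
    ([sub_closed_convex_hull_active]).

    For the other inclusion, take a subgradient xs of F at x.  A functional in a
    weak*-closed convex set C containing the restricted subgradients is tested on
    finitely many points y_i only; enlarging L by the y_i shrinks the sets of
    restricted subgradients, so everything takes place in one finite-dimensional
    subspace.  If xs were not approximated by C
    on the y_i, a finite-dimensional separation ([separate_from_origin]) would
    produce v in the span of the y_i with (u - xs) v bounded by some - delta < 0
    for all u in C.  After subtracting xs and translating x to 0, it therefore
    suffices to find, for every v and delta, an active index t and a functional
    u below g t d := f t (x + d) - F x - xs d, on the part D of dom F - x in that
    subspace, such that - delta < u v ([exists_active_subgradient_gt]).  The functions g t have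
    supremum >= 0 on D and are <= 0 at the origin.

    Three facts carry this last statement.
    - Compactness ([active_ray]): on a segment [0, z] in D, a single active g t
      is nonnegative.  For small s > 0 the indices t with g t (s z) >= - s^2
      form a nonempty, relatively closed subset of the compact set of
      eps0-active indices; these subsets decrease with s, and any t in their
      intersection works.
    - Support ([subgradient_at_core_point]): if z is moreover a relative interior
      point of D, such a g t has a subgradient u at 0 with u z >= 0.
    - Normal directions ([functional_negative_on_cone]): if v is outside the
      closure of the cone generated by D, some functional is <= 0 on D and
      positive at v; adding a large multiple of it to any subgradient makes the
      value at v as large as desired.
    In the remaining case v is a limit of points v + s w, with w and hence
    v + s w relatively interior to the cone, and the first two facts apply to
    them; u w is bounded above independently of s, so u v > - delta for small s.

    All functionals come from one form of the Hahn-Banach theorem, for cones in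
    V * R ([hahn_banach_cone]). *)

(** * The Hahn-Banach theorem for cones *)

Section hahn_banach.
Context {R : realType} {V : lmodType R}.
Implicit Types (S : set (V * R)) (v : V) (a : R).

(** A pair (v, a) in S is read as the constraint phi v <= a on a linear functional
    phi.  Constraints can be added and rescaled, and are consistent when none of
    them bounds phi 0 by a negative number.  Encoding the constraints themselves,
    rather than a sublinear function, avoids infima over auxiliary parameters in
    each application. *)
Definition epi_cone S :=
  [/\ forall p q, S p -> S q -> S (p + q),
      forall k p, 0 < k -> S p -> S (k *: p.1, k * p.2) &
      forall a, S (0, a) -> 0 <= a].

(** Zorn's lemma is applied to the sets A for which S together with A is a cone,
    so that the empty chain is no exception. *)
Lemma maximal_epi_cone S : epi_cone S ->
  exists2 M, S `<=` M & epi_cone M /\ forall N, epi_cone N -> M `<=` N -> N = M.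
Proof.
move=> coneS; have [] := @Zorn_bigcup _ [set A | epi_cone (S `|` A)].
  move=> F Fcone Ftot; pose U := S `|` \bigcup_(A in F) A.
  have chain p q : U p -> U q ->
      exists2 A, epi_cone A & [/\ A `<=` U, A p & A q].
    have SU A : F A -> S `|` A `<=` U.
      by move=> FA; apply: setUS; exact: bigcup_sup.
    move=> [Sp|[A FA Ap]] [Sq|[B FB Bq]].
    - by exists S => //; split=> //; exact: subsetUl.
    - by exists (S `|` B); [exact: Fcone|split; [exact: SU|left|right]].
    - by exists (S `|` A); [exact: Fcone|split; [exact: SU|right|left]].
    - have [AB|BA] := Ftot _ _ FA FB.
        by exists (S `|` B); [exact: Fcone|split; [exact: SU|right; exact: AB|right]].
      by exists (S `|` A); [exact: Fcone|split; [exact: SU|right|right; exact: BA]].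
  split=> [p q Up Uq|k p k0 Up|a Ua].
  - by have [A [coneD _ _] [AU Ap Aq]] := chain _ _ Up Uq; apply/AU/coneD.
  - by have [A [_ coneZ _] [AU Ap _]] := chain _ _ Up Up; apply/AU/coneZ.
  - by have [A [_ _ cone0] [_ Aa _]] := chain _ _ Ua Ua; exact: cone0.
move=> A [coneA maxA]; exists (S `|` A); first exact: subsetUl.
split=> // N coneN SAN; apply/seteqP; split=> // p Np.
have [//|nSAp] := pselect ((S `|` A) p).
have /maxA : A `<` N.
  split; first by move=> ? ?; apply: SAN; right.
  by move=> NA; apply: nSAp; right; exact: NA.
by case; rewrite /= setUidr// => ? ?; apply: SAN; left.
Qed.

(** The cone generated by S and (v, a) is strictly larger than S, so by maximality
    it is inconsistent: some (- k v, b) in S with k > 0 has b + k a < 0, and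
    rescaling this pair by 1 / k gives the constraint sought. *)
Lemma maximal_epi_cone_reflect S v a : epi_cone S -> S (0, 0) ->
    (forall N, epi_cone N -> S `<=` N -> N = S) ->
  ~ S (v, a) -> exists2 b, b < - a & S (- v, b).
Proof.
move=> [SD SZ S0] S00 maxS nSva.
pose N := [set p : V * R | exists2 q, S q & exists2 k, 0 <= k &
  p = (q.1 + k *: v, q.2 + k * a)].
have SN : S `<=` N.
  by move=> [u b] Sub; exists (u, b) => //; exists 0; rewrite // scale0r mul0r !addr0.
have [nconeN|] := pselect (~ epi_cone N); last first.
  move=> /contrapT/maxS/(_ SN) NS; case: nSva; rewrite -NS.
  by exists (0, 0) => //; exists 1 => //=; rewrite scale1r mul1r !add0r.
suff [k [k0 [b Sb]]] : exists k, 0 < k /\ exists2 b, S (- (k *: v), b) & b + k * a < 0.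
  move=> ba0; exists (k^-1 * b).
    by rewrite -(ltr_pM2l k0) mulrA divff ?gt_eqF// mul1r; lra.
  have /= := SZ k^-1 _ _ Sb; rewrite invr_gt0 => /(_ k0).
  by rewrite scalerN scalerA mulVf ?gt_eqF// scale1r.
apply: contrapT => nk; apply: nconeN; split.
- move=> p q [p' Sp [k k0 ->]] [q' Sq [l l0 ->]].
  exists (p' + q'); first exact: SD.
  exists (k + l); first exact: addr_ge0.
  by congr pair => /=; rewrite ?scalerDl ?mulrDl addrACA.
- move=> k p k0 [q Sq [l l0 ->]] /=.
  exists (k *: q.1, k * q.2); first exact: SZ.
  exists (k * l); first by rewrite mulr_ge0// ltW.
  by rewrite scalerDr scalerA mulrDr mulrA.
- move=> c [[u b] Sq [k]]; rewrite le_eqVlt => /orP[/eqP <-|k0] /= [u0 ->].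
    by rewrite mul0r addr0; apply: S0; rewrite u0 scale0r addr0.
  rewrite leNgt; apply/negP => cneg; apply: nk; exists k; split => //; exists b => //.
  by rewrite (_ : - (k *: v) = u)//; apply/eqP; rewrite eq_sym -addr_eq0 -u0.
Qed.

(** For a maximal cone M the infimum phi of {a | M (v, a)} is sublinear, and
    [maximal_epi_cone_reflect] makes it odd, hence linear. *)
Lemma hahn_banach_cone S : epi_cone S -> (forall v, exists a, S (v, a)) ->
  exists phi : {linear V -> R^o}, forall v a, S (v, a) -> phi v <= a.
Proof.
move=> coneS domS.
pose S' := [set p | S p \/ p = 0].
have coneS' : epi_cone S'.
  have [SD SZ S0] := coneS; split=> [p q|k p k0|a].
  - move=> [Sp|->] [Sq|->]; rewrite ?addr0 ?add0r; [left; exact: SD|by left|by left|by right].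
  - by move=> [Sp|->]; [left; exact: SZ|right; rewrite scaler0 mulr0].
  - by move=> [/S0//|[->]].
have [M SM [coneM maxM]] := maximal_epi_cone coneS'.
have [MD MZ M0] := coneM; have M00 : M (0, 0) by apply: SM; right.
pose E v := [set a | M (v, a)]; pose phi v := inf (E v).
have E0 v : E v !=set0 by have [a Sa] := domS v; exists a; apply: SM; left.
have Elb v : has_lbound (E v).
  have [b Mb] := E0 (- v); exists (- b) => a Ma.
  have : M (v - v, a + b) by exact: MD Ma Mb.
  by rewrite subrr => /M0; lra.
have phi_le v a : M (v, a) -> phi v <= a by move=> Ma; exact: ge_inf.
have le_phi v c : (forall a, M (v, a) -> c <= a) -> c <= phi v.
  by move=> h; apply: lb_le_inf => // a; exact: h.
have phiD_le u v : phi (u + v) <= phi u + phi v.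
  rewrite -lerBlDr; apply: (le_phi) => a Ma.
  rewrite lerBlDr [a + _]addrC -lerBlDr; apply: (le_phi) => b Mb.
  by rewrite lerBlDr [b + _]addrC; apply: (phi_le); exact: MD Ma Mb.
have phi0 : phi 0 = 0.
  by apply/le_anti; rewrite phi_le//= le_phi// => a /M0.
have phiN v : phi (- v) = - phi v.
  apply/le_anti/andP; split; last first.
    by rewrite -subr_ge0 opprK; apply: le_trans (phiD_le _ _); rewrite addrC subrr phi0.
  rewrite lerNr -subr_ge0 -oppr_le0 leNgt; apply/negP => h.
  (* a level strictly between - phi (- v) and phi v *)
  pose a := (- phi (- v) + phi v) / 2.
  have [|b ba /phi_le] := @maximal_epi_cone_reflect M v a coneM M00 maxM.
    by move=> /phi_le; rewrite /a; lra.
  by rewrite /a in ba *; lra.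
have phiZ_le k v : 0 < k -> phi (k *: v) <= k * phi v.
  move=> k0; rewrite -ler_pdivrMl//; apply: (le_phi) => a /(MZ _ _ k0)/phi_le /=.
  by rewrite ler_pdivrMl.
have phiZp k v : 0 < k -> phi (k *: v) = k * phi v.
  move=> k0; apply/le_anti; rewrite phiZ_le//=.
  have := phiZ_le k^-1 (k *: v); rewrite invr_gt0 => /(_ k0).
  by rewrite scalerA mulVf ?gt_eqF// scale1r ler_pdivlMl.
have phi_linear : linear (phi : V -> R^o).
  move=> k u v; have phiD x y : phi (x + y) = phi x + phi y.
    apply/le_anti; rewrite phiD_le /=.
    have := phiD_le (- x) (- y); rewrite -opprD !phiN; lra.
  rewrite phiD; congr (_ + _).
  have [k0|k0|->] := ltgtP k 0; last by rewrite !scale0r phi0.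
    by rewrite -[k *: u]opprK -scaleNr phiN phiZp ?oppr_gt0// mulNr opprK.
  exact: phiZp.
pose phiL : {linear V -> R^o} :=
  HB.pack (phi : V -> R^o) (GRing.isLinear.Build R V R^o *:%R (phi : V -> R^o) phi_linear).
by exists phiL => v a Sva; apply: (phi_le); apply: SM; left.
Qed.

End hahn_banach.

(** Sums a d + b d' of multiples of points of a convex set are again multiples
    (a + b) d'' with d'' = l d + (1 - l) d'.  The case a + b = 0 is included. *)
Lemma convex_weight {R : realType} (a b : R) : 0 <= a -> 0 <= b ->
  exists l, [/\ 0 <= l <= 1, (a + b) * l = a & (a + b) * (1 - l) = b].
Proof.
move=> a0 b0; have [ab0|ab0] := eqVneq (a + b) 0.
  have [-> ->] : a = 0 /\ b = 0 by split; lra.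
  by exists 0; split; rewrite ?lexx ?ler01//; lra.
have ab : 0 < a + b by rewrite lt_neqAle eq_sym ab0 addr_ge0.
exists (a / (a + b)); split.
- by rewrite divr_ge0 ?addr_ge0//= ler_pdivrMr// mul1r lerDl.
- by rewrite mulrC divfK.
- by rewrite mulrBr mulr1 [_ * (a / _)]mulrC divfK//; lra.
Qed.

(** * The dual of a locally convex space *)

Section segment_closed.
Context {R : realType} {V : lmodType R}.

(** Convexity with real coefficients, free of the interval type and of the convex
    structure that enter [convex_set]. *)
Definition segment_closed (D : set V) := forall (l : R) y z,
  0 <= l <= 1 -> D y -> D z -> D (l *: y + (1 - l) *: z).

Lemma convex_set_segment_closed (D : set V) : convex_set D -> segment_closed D.
Proof.
move=> convD l y z /andP[l0 l1] Dy Dz.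
by have := convD y z (Itv01 l0 l1) (mem_set Dy) (mem_set Dz); rewrite inE.
Qed.

End segment_closed.

Section dual.
Context {R : realType} {X : tvsType R}.
Implicit Types (u : dual X) (z : X).

Lemma dual_linear u : linear (dual_val u).
Proof. by have := dual_valP u; rewrite inE => -[]. Qed.

HB.instance Definition _ u :=
  GRing.isLinear.Build R X R^o *:%R (dual_val u) (dual_linear u).

Lemma dualE (k : R) u u' z : (k *: u + u') z = k * u z + u' z.
Proof. by []. Qed.

Lemma dual_sumE n (c : 'I_n -> R) (u : 'I_n -> dual X) z :
  (\sum_i c i *: u i) z = \sum_i c i * u i z.
Proof. by elim/big_rec2: _ => // i a b _ <-. Qed.

Lemma continuous_linear_bounded_above (U : set X) (phi : {linear X -> R^o}) :
  nbhs 0 U -> (forall z, U z -> phi z <= 1) -> continuous phi.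
Proof.
move=> U0 phiU x; apply/cvgrPdist_le => e e0.
have : nbhs 0 (U `&` (-%R @` U)) by apply: filterI; [|exact: nbhs0N].
move=> /(nbhs0Z (lt0r_neq0 e0))/(nbhsT x).
apply: filterS => _ [_ [w [Uw [w' Uw' ww']] <-] <-].
rewrite linearD opprD addrA subrr add0r normrN linearZ/= normrM (gtr0_norm e0).
rewrite -[leRHS]mulr1 ler_pM2l// ler_norml phiU// andbT.
by rewrite -ww' linearN lerN2 phiU.
Qed.

(** If z <> 0, some convex neighbourhood U of 0 misses z; the constraints phi <= 1
    on U and phi z >= 1 are then consistent, and the first one makes phi
    continuous. *)
Lemma dual_separates_points (hX : hausdorff_space X) z :
  (forall u : dual X, u z = 0) -> z = 0.
Proof.
move=> uz0; apply: contrapT => /eqP; rewrite eq_sym => z0.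
have [A [Aopen]] := hausdorff_accessible hX z0; rewrite !inE => A0 nAz.
have [B convB [Bopen /(_ 0) B_basis]] := @locally_convex R X.
have [U [BU U0] UA] : filter_from [set U | B U /\ U 0] id A.
  by apply: B_basis; exact: open_nbhs_nbhs.
have nbhsU : nbhs 0 U by apply: open_nbhs_nbhs; split => //; exact: Bopen.
have convU := convex_set_segment_closed (convB _ (mem_set BU)).
pose S := [set p : X * R | exists k r w,
  [/\ 0 <= k, 0 <= r, U w, p.1 = k *: w - r *: z & k - r <= p.2]].
have coneS : epi_cone S.
  split=> [p q|k p k0|a].
  - move=> [k [r [w [k0 r0 Uw p1 p2]]]] [k' [r' [w' [k0' r0' Uw' q1 q2]]]].
    have [l [l01 lk lk']] := convex_weight k0 k0'.
    exists (k + k'), (r + r'), (l *: w + (1 - l) *: w'); split.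
    + exact: addr_ge0.
    + exact: addr_ge0.
    + exact: convU.
    + rewrite scalerDr !scalerA lk lk' /= p1 q1 scalerDl opprD addrACA //.
    + by rewrite /=; lra.
  - move=> [l [r [w [l0 r0 Uw p1 p2]]]]; exists (k * l), (k * r), w; split => //.
    + by rewrite mulr_ge0// ltW.
    + by rewrite mulr_ge0// ltW.
    + by rewrite /= p1 scalerBr !scalerA.
    + by rewrite /= -mulrBr ler_pM2l.
  - move=> [k [r [w [k0 r0 Uw /= /esym/eqP]]]]; rewrite subr_eq0 => /eqP kwrz.
    apply: le_trans; rewrite subr_ge0 leNgt; apply/negP => kr.
    have r_gt0 : 0 < r by exact: le_lt_trans kr.
    apply: nAz; apply: UA.
    have -> : z = (k / r) *: w + (1 - k / r) *: 0.
      rewrite scaler0 addr0 mulrC -scalerA kwrz scalerA mulVf ?scale1r//.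
      exact: lt0r_neq0.
    by apply: convU => //; rewrite ler_pdivrMr// mul1r divr_ge0//= ltW.
(* U is absorbing *)
have domS x : exists a, S (x, a).
  have : \forall k \near (0 : R^o), U (k *: x).
    have /= := @scale_continuous R X (0, x) U.
    rewrite scale0r => /(_ nbhsU)[[P Q] /= [P0 Qx] PQ].
    by apply: filterS P0 => k Pk; apply: (PQ (k, x)); split => //=; exact: nbhs_singleton.
  move=> /nbhs_ballP[e /= e0 Ue].
  have Uex : U ((e / 2) *: x).
    apply: (Ue (e / 2)); rewrite -ball_normE/= sub0r normrN gtr0_norm ?divr_gt0//.
    by rewrite ltr_pdivrMr// ltr_pMr// ltr1n.
  exists (2 / e), (2 / e), 0, ((e / 2) *: x); split => //.
  - by rewrite divr_ge0// ltW.
  - rewrite /= scale0r subr0 scalerA.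
    by rewrite -[2 / e]invf_div mulVf ?scale1r// lt0r_neq0// divr_gt0.
  - by rewrite subr0.
have [phi phiS] := hahn_banach_cone coneS domS.
have cphi : continuous phi.
  apply: (continuous_linear_bounded_above nbhsU) => x Ux; apply: phiS.
  by exists 1, 0, x; split; rewrite ?ler01 ?scale1r ?scale0r ?subr0.
have phiC : (phi : X -> R^o) \in continuous_linear X.
  by rewrite inE; split => //; exact: linearP.
have : phi (- z) <= -1.
  by apply: phiS; exists 0, 1, 0; split; rewrite ?ler01 ?scale0r ?scale1r ?sub0r.
have /= phiz := uz0 (Dual phiC).
by rewrite linearN phiz; lra.
Qed.
End dual.

(** * Finite-dimensional subspaces *)

Section finite_dimension.

(** A matrix of maximal rank among those with rows in W; adding a row of W to it
    cannot increase the rank. *)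
Lemma exists_spanning_rows {F : fieldType} n (W : set 'rV[F]_n) :
  exists m (M : 'M[F]_(m, n)),
    (forall j, W (row j M)) /\ forall w, W w -> (w <= M)%MS.
Proof.
pose P r := `[< exists m (M : 'M[F]_(m, n)),
  (forall j, W (row j M)) /\ \rank M = r >].
have P0 : exists r, P r.
  by exists 0%N; apply/asboolP; exists 0%N, 0; split; [case|rewrite mxrank0].
have Pn r : P r -> (r <= n)%N.
  by move=> /asboolP[m [M [_ <-]]]; exact: rank_leq_col.
case: (ex_maxnP P0 Pn) => r /asboolP[m [M [MW Mr]]] maxr.
exists m, M; split => // w Ww.
have MMw : (M <= col_mx M w)%MS by rewrite -addsmxE addsmxSl.
have : (col_mx M w <= M)%MS.
  rewrite -(mxrank_leqif_sup MMw) eqn_leq mxrankS//= Mr; apply: maxr.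
  apply/asboolP; exists (m + 1)%N, (col_mx M w); split => // j.
  case: (split_ordP j) => k ->; first by rewrite rowKu.
  by rewrite rowKd row_id.
by apply: submx_trans; rewrite -addsmxE addsmxSr.
Qed.

Context {R : realType} {X : lmodType R}.

Definition lincomb n (e : 'I_n -> X) (c : 'rV[R]_n) : X := \sum_i c 0 i *: e i.

Lemma lincomb_is_linear n (e : 'I_n -> X) : linear (lincomb e).
Proof.
move=> k c d; rewrite /lincomb scaler_sumr -big_split/=; apply: eq_bigr => i _.
by rewrite !mxE scalerDl scalerA.
Qed.

HB.instance Definition _ n (e : 'I_n -> X) :=
  GRing.isLinear.Build R 'rV[R]_n X *:%R (lincomb e) (lincomb_is_linear e).

Lemma lincomb_mulmx n m (e : 'I_n -> X) (b : 'rV[R]_m) (M : 'M[R]_(m, n)) :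
  lincomb e (b *m M) = lincomb (fun j => lincomb e (row j M)) b.
Proof.
rewrite mulmx_sum_row linear_sum; apply: eq_bigr => i _; exact: linearZ.
Qed.

Lemma exists_spanning_family n (e : 'I_n -> X) (D : set X) :
    D `<=` range (lincomb e) ->
  exists m (d : 'I_m -> X), (forall j, D (d j)) /\ D `<=` range (lincomb d).
Proof.
move=> De; have [m [M [MW WM]]] := exists_spanning_rows [set c | D (lincomb e c)].
exists m, (fun j => lincomb e (row j M)); split=> [j|y Dy]; first exact: MW.
have [c _ cy] := De _ Dy; subst y.
by have /submxP[b ->] := WM _ Dy; exists b; rewrite // lincomb_mulmx.
Qed.

End finite_dimension.

Section dual_finite_dimension.
Context {R : realType} {X : tvsType R} (hX : hausdorff_space X).

Lemma linear_row_lincomb n (phi : {linear 'rV[R]_n -> R^o}) c :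
  phi c = \sum_i c 0 i * phi (delta_mx 0 i).
Proof.
by rewrite {1}[c]row_sum_delta linear_sum; apply: eq_bigr => i _; exact: linearZ.
Qed.

(** The vectors (u (e i))_i for u in the dual form a subspace of R^n.  If b were
    outside, a vector c of coefficients would vanish on that subspace but not at b;
    then every u vanishes at the combination of the e i with coefficients c, which
    is therefore 0, and c vanishes at b by compatibility. *)
Lemma dual_interpolation n (e : 'I_n -> X) (b : 'I_n -> R) :
    (forall c : 'rV[R]_n, lincomb e c = 0 -> \sum_i c 0 i * b i = 0) ->
  exists u : dual X, forall i, u (e i) = b i.
Proof.
move=> eb; have [m [M [MW WM]]] :=
  exists_spanning_rows [set w | exists u : dual X, w = \row_i u (e i)].
have [bM|nbM] := boolP (\row_i b i <= M)%MS.
  have [u uM] := choice MW; have /submxP[c bc] := bM.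
  exists (\sum_j c 0 j *: u j) => i; rewrite dual_sumE.
  move/rowP : bc => /(_ i); rewrite !mxE => ->; apply: eq_bigr => j _.
  by have /rowP/(_ i) := uM j; rewrite !mxE => ->.
move: nbM; rewrite submxE => /eqP nbM; case: nbM; apply/rowP => k.
(* the columns of cokermx M are the equations of the row space of M *)
pose c : 'rV[R]_n := \row_i cokermx M i k.
have uc (u : dual X) : u (lincomb e c) = 0.
  have : (\row_i u (e i) <= M)%MS by apply: WM; exists u.
  rewrite submxE => /eqP/rowP/(_ k); rewrite !mxE => uM.
  rewrite linear_sum -[RHS]uM; apply: eq_bigr => i _.
  by rewrite linearZ/= !mxE mulrC.
rewrite !mxE -[RHS](eb c (dual_separates_points hX uc)).
by apply: eq_bigr => i _; rewrite !mxE mulrC.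
Qed.

(** Hahn-Banach for constraints living on a finite-dimensional subspace, with a
    continuous functional as the result.  The domain of S is a subspace, since it
    is symmetric; in coordinates over a finite family d spanning it every vector is
    constrained, and the resulting functional is the restriction of an element of
    the dual by [dual_interpolation]. *)
Lemma dual_below_cone n (e : 'I_n -> X) (S : set (X * R)) :
    epi_cone S -> S (0, 0) ->
    (forall y a, S (y, a) -> range (lincomb e) y) ->
    (forall y a, S (y, a) -> exists b, S (- y, b)) ->
  exists u : dual X, forall y a, S (y, a) -> u y <= a.
Proof.
move=> coneS S00 Se SN; have [SD SZ S0] := coneS.
have [m [d [Sd dS]]] : exists m (d : 'I_m -> X),
    (forall j, exists a, S (d j, a)) /\
    [set y | exists a, S (y, a)] `<=` range (lincomb d).
  by apply: (@exists_spanning_family _ _ _ e) => y [a]; exact: Se.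
have domS c : exists a, S (lincomb d c, a).
  have domZ k y : (exists a, S (y, a)) -> exists a, S (k *: y, a).
    move=> [a Sya]; have [k0|k0|->] := ltgtP k 0.
    - have [b Syb] := SN _ _ Sya; exists (- k * b).
      have /= := SZ (- k) _ _ Syb; rewrite oppr_gt0 => /(_ k0).
      by rewrite scalerN scaleNr opprK.
    - by exists (k * a); exact: SZ _ _ k0 Sya.
    - by exists 0; rewrite scale0r.
  rewrite /lincomb; elim/big_rec : _ => [|j y _ [a Sya]]; first by exists 0.
  by have [b Sb] := domZ (c 0 j) _ (Sd j); exists (b + a); exact: SD Sb Sya.
pose S' := [set p : 'rV[R]_m * R | S (lincomb d p.1, p.2)].
have coneS' : epi_cone S'.
  split=> [p q Sp Sq|k p k0 Sp|a].
  - by rewrite /S'/= linearD; exact: SD Sp Sq.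
  - by rewrite /S'/= linearZ; exact: SZ _ _ k0 Sp.
  - by rewrite /S'/= linear0; exact: S0.
have [phi phiS] := hahn_banach_cone coneS' domS.
have phi0 c : lincomb d c = 0 -> phi c = 0.
  move=> c0; apply/le_anti/andP; split; first by apply: (phiS); rewrite /S'/= c0.
  by rewrite -oppr_le0 -linearN; apply: (phiS); rewrite /S'/= linearN/= c0 oppr0.
have [u ud] : exists u : dual X, forall j, u (d j) = phi (delta_mx 0 j).
  by apply: dual_interpolation => c /phi0; rewrite linear_row_lincomb.
exists u => y a Sya; have [|c _ yc] := dS y; first by exists a.
suff -> : u y = phi c by apply: phiS; rewrite /S'/= yc.
rewrite -yc linear_row_lincomb linear_sum; apply: eq_bigr => j _.
by rewrite linearZ/= ud.
Qed.

End dual_finite_dimension.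

(** * Relative interior points of convex sets *)

Section conical_hull.
Context {R : realType} {X : lmodType R}.
Implicit Types (D : set X) (y z w : X) (h : X -> R).

Definition convex_fun_on D h := forall l y z, 0 <= l <= 1 -> D y -> D z ->
  h (l *: y + (1 - l) *: z) <= l * h y + (1 - l) * h z.

(** Asking for 0 < k rather than 0 <= k loses nothing when D contains 0, and lets
    a point of the cone be rescaled into D. *)
Definition conical D := [set y | exists k d, [/\ 0 < k, D d & y = k *: d]].

(** Algebraic relative interior points, seen from the origin: every direction of the
    span of D is reached in the cone after adding a multiple of w. *)
Definition core_point D w :=
  forall y, D y -> exists2 r, 0 <= r & conical D (r *: w - y).

Context (D : set X).
Context (convD : segment_closed D) (D0 : D 0).

Lemma subset_conical y : D y -> conical D y.
Proof. by move=> Dy; exists 1, y; rewrite scale1r. Qed.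

Lemma conicalD y z : conical D y -> conical D z -> conical D (y + z).
Proof.
move=> [k [d [k0 Dd ->]]] [k' [d' [k0' Dd' ->]]].
have [l [l01 lk lk']] := convex_weight (ltW k0) (ltW k0').
exists (k + k'), (l *: d + (1 - l) *: d'); split; first exact: addr_gt0.
  exact: convD.
by rewrite scalerDr !scalerA lk lk'.
Qed.

Lemma conicalZ k y : 0 <= k -> conical D y -> conical D (k *: y).
Proof.
rewrite le_eqVlt => /orP[/eqP <- _|k0 [l [d [l0 Dd ->]]]].
  by rewrite scale0r; exact: subset_conical.
by exists (k * l), d; rewrite scalerA mulr_gt0.
Qed.

Lemma conical_sum n (c : 'I_n -> R) (d : 'I_n -> X) :
  (forall i, 0 <= c i) -> (forall i, D (d i)) -> conical D (\sum_i c i *: d i).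
Proof.
move=> c0 Dd; apply: big_ind => [|y z|i _]; first exact: subset_conical.
  exact: conicalD.
by apply: conicalZ => //; exact: subset_conical.
Qed.

(** In the cone, the sum of a finite family of points of D spanning D is interior:
    subtracting a combination of the family from a large multiple of the sum leaves
    nonnegative coefficients. *)
Lemma exists_core_point n (e : 'I_n -> X) : D `<=` range (lincomb e) ->
  exists2 w, D w & core_point D w.
Proof.
move=> De; have [m [d [Dd dD]]] := exists_spanning_family De.
have [k [w [k0 Dw kw]]] : conical D (\sum_i 1 *: d i) by exact: conical_sum.
exists w => // y Dy; have [c _ cy] := dD _ Dy.
pose r := \sum_i `|c 0 i|.
have cr i : c 0 i <= r.
  rewrite /r (bigD1 i)//= (le_trans (ler_norm _))// lerDl.
  by apply: sumr_ge0 => j _.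
exists (r * k); first by rewrite mulr_ge0 ?(ltW k0)// sumr_ge0.
rewrite -scalerA -kw -cy scaler_sumr /lincomb -sumrB.
under eq_bigr do rewrite scale1r -scalerBl.
by apply: conical_sum => // i; rewrite subr_ge0.
Qed.

End conical_hull.

Section core_functionals.
Context {R : realType} {X : tvsType R} (hX : hausdorff_space X).
Context (D : set X) (n : nat) (e : 'I_n -> X).
Context (convD : segment_closed D) (D0 : D 0) (De : D `<=` range (lincomb e)).

Let rangeD y z : range (lincomb e) y -> range (lincomb e) z ->
  range (lincomb e) (y + z).
Proof. by move=> [c _ <-] [d _ <-]; exists (c + d); rewrite // linearD. Qed.

Let rangeZ k y : range (lincomb e) y -> range (lincomb e) (k *: y).
Proof. by move=> [c _ <-]; exists (k *: c); rewrite // linearZ. Qed.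

(** The constraints are u d <= h d for d in D and u w >= 0, that is
    u (k d - r w) <= k h d for k, r >= 0.  They are consistent because h is
    nonnegative on the ray through w: on [0, w] by assumption, beyond w by
    convexity.  They concern a subspace because w is a core point. *)
Lemma subgradient_at_core_point (h : X -> R) (w : X) :
    convex_fun_on D h -> h 0 = 0 -> D w -> core_point D w ->
    (forall s, 0 <= s <= 1 -> 0 <= h (s *: w)) ->
  exists2 u : dual X, (forall y, D y -> u y <= h y) & 0 <= u w.
Proof.
move=> convh h0 Dw corew hw.
pose S := [set p : X * R | exists k r d,
  [/\ 0 <= k, 0 <= r, D d, p.1 = k *: d - r *: w & k * h d <= p.2]].
have coneS : epi_cone S.
  split=> [p q|k p k0|a].
  - move=> [k [r [d [k0 r0 Dd p1 p2]]]] [k' [r' [d' [k0' r0' Dd' q1 q2]]]].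
    have [l [l01 lk lk']] := convex_weight k0 k0'.
    exists (k + k'), (r + r'), (l *: d + (1 - l) *: d'); split.
    + exact: addr_ge0.
    + exact: addr_ge0.
    + exact: convD.
    + by rewrite scalerDr !scalerA lk lk' /= p1 q1 scalerDl opprD addrACA.
    + apply: le_trans (lerD p2 q2).
      apply: le_trans (ler_wpM2l (addr_ge0 k0 k0') (convh _ _ _ l01 Dd Dd')) _.
      by rewrite mulrDr !mulrA lk lk'.
  - move=> [l [r [d [l0 r0 Dd p1 p2]]]]; exists (k * l), (k * r), d; split => //.
    + by rewrite mulr_ge0// ltW.
    + by rewrite mulr_ge0// ltW.
    + by rewrite /= p1 scalerBr !scalerA.
    + by rewrite /= -mulrA ler_pM2l.
  - move=> [k [r [d [k0 r0 Dd /= /esym/eqP]]]]; rewrite subr_eq0 => /eqP kdrw.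
    apply: le_trans; move: k0; rewrite le_eqVlt => /orP[/eqP <-|k0].
      by rewrite mul0r.
    rewrite mulr_ge0 ?(ltW k0)//.
    have dw : d = (r / k) *: w.
      by rewrite mulrC -scalerA -kdrw scalerA mulVf ?scale1r// gt_eqF.
    have [rk|kr] := leP r k.
      by rewrite dw hw// divr_ge0 ?(ltW k0)//= ler_pdivrMr// mul1r.
    have r_gt0 := lt_trans k0 kr.
    have : 0 <= h (1 *: w) by apply: hw; rewrite ler01 lexx.
    have -> : 1 *: w = (k / r) *: d + (1 - k / r) *: 0.
      rewrite scaler0 addr0 scale1r mulrC -scalerA kdrw scalerA mulVf ?scale1r//.
      by rewrite gt_eqF.
    have kr01 : 0 <= k / r <= 1.
      by rewrite divr_ge0 ?(ltW k0)//= ler_pdivrMr// mul1r ltW.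
    move=> /le_trans/(_ (convh _ _ _ kr01 Dd D0)).
    by rewrite h0 mulr0 addr0 pmulr_rge0 ?divr_gt0.
have [||y a|u uS] := dual_below_cone hX (e := e) coneS.
- by exists 0, 0, 0; split; rewrite ?scale0r ?subr0 ?mul0r.
- move=> y a [k [r [d [k0 r0 Dd /= -> _]]]].
  by rewrite -scaleNr; apply: rangeD; apply: rangeZ; exact: De.
- move=> [k [r [d [k0 r0 Dd /= -> _]]]].
  have [r' r0' corew'] := corew _ Dd.
  have [k'' [d'' [k0'' Dd'' kd]]] : conical D (k *: (r' *: w - d) + r *: w).
    apply: conicalD => //; apply: conicalZ => //; exact: subset_conical.
  exists (k'' * h d''), k'', (k * r'), d''; split => //=; first exact: ltW.
    exact: mulr_ge0.
  by rewrite -kd scalerBr scalerA opprB [RHS]addrC !addrA addNr add0r addrC.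
exists u => [y Dy|].
  by apply: uS; exists 1, 0, y; split; rewrite ?scale1r ?scale0r ?subr0 ?mul1r ?ler01.
rewrite -oppr_le0 -linearN; apply: uS; exists 0, 1, 0.
by split; rewrite ?scale0r ?scale1r ?sub0r ?mul0r ?ler01.
Qed.

(** Separation of v from the cone, in terms of the distance r travelled along w.
    The constraints are u <= 0 on D, u w >= - 1 and u v = s, the equality being
    expressed by a coefficient t of arbitrary sign.  They are inconsistent only if
    v + r w lies in the cone for some r < s, but then v + s w does as well. *)
Lemma functional_negative_on_cone (w v : X) (s : R) :
    D w -> core_point D w -> range (lincomb e) v -> 0 < s ->
    ~ conical D (v + s *: w) ->
  exists2 u : dual X, (forall y, D y -> u y <= 0) & 0 < u v.
Proof.
move=> Dw corew ev s0 nvsw.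
have Cw := subset_conical Dw; have C0 := subset_conical D0.
pose S := [set p : X * R | exists r t q,
  [/\ 0 <= r, conical D q, p.1 = q - t *: v - r *: w & r - t * s <= p.2]].
have coneS : epi_cone S.
  split=> [p q|k p k0|a].
  - move=> [r [t [y [r0 Cy p1 p2]]]] [r' [t' [y' [r0' Cy' q1 q2]]]].
    exists (r + r'), (t + t'), (y + y'); split.
    + exact: addr_ge0.
    + exact: conicalD.
    + by rewrite /= p1 q1 !scalerDl !opprD addrACA; congr (_ + _); rewrite addrACA.
    + by rewrite /=; lra.
  - move=> [r [t [y [r0 Cy p1 p2]]]]; exists (k * r), (k * t), (k *: y); split => //.
    + by rewrite mulr_ge0// ltW.
    + by apply: conicalZ => //; exact: ltW.
    + by rewrite /= p1 !scalerBr !scalerA.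
    + by rewrite /= -mulrA -mulrBr ler_pM2l.
  - move=> [r [t [y [r0 Cy /= /esym/eqP]]]].
    rewrite -addrA -opprD subr_eq0 => /eqP ytr; apply: le_trans.
    rewrite leNgt; apply/negP => rts; apply: nvsw.
    have t0 : 0 < t by rewrite -(pmulr_lgt0 _ s0); lra.
    have -> : v + s *: w = t^-1 *: y + (s - r / t) *: w.
      rewrite ytr scalerDr !scalerA mulVf ?gt_eqF// scale1r -addrA -scalerDl.
      by rewrite [t^-1 * r]mulrC [r / t + _]addrC subrK.
    apply: conicalD => //; apply: conicalZ => //; first by rewrite invr_ge0 ltW.
    by rewrite subr_ge0 ler_pdivrMr// mulrC; lra.
have [||y a|u uS] := dual_below_cone hX (e := e) coneS.
- by exists 0, 0, 0; split; rewrite ?scale0r ?subr0 ?mul0r ?subr0.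
- move=> y a [r [t [q [r0 [k [d [_ Dd ->]]] /= -> _]]]].
  by rewrite -!scaleNr; apply: rangeD; [apply: rangeD|]; apply: rangeZ => //; exact: De.
- move=> [r [t [q [r0 [k [d [k0 Dd ->]]] /= -> _]]]].
  have [r' r0' corew'] := corew _ Dd.
  exists (k * r' - (- t) * s), (k * r'), (- t), (k *: (r' *: w - d) + r *: w).
  split => //=; first by rewrite mulr_ge0// ltW.
    by apply: conicalD => //; apply: conicalZ => //; exact: ltW.
  rewrite scaleNr scalerBr scalerA opprK !opprD !opprK.
  by rewrite [RHS]addrC !addrA addNr add0r addrAC.
exists u => [y Dy|].
  apply: uS; exists 0, 0, y; split; rewrite ?scale0r ?subr0 ?mul0r ?subr0//.
  exact: subset_conical.
have : u (- v) <= - s.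
  by apply: uS; exists 0, 1, 0; split; rewrite ?scale0r ?scale1r ?sub0r ?mul1r ?subr0.
by rewrite linearN; lra.
Qed.

End core_functionals.

(** * Active functions along a segment *)

(** Here h t is a convex function on [0, 1].  For small s, a function with
    h t s >= - s^2 must have its index in K, since h t 0 <= - eps and h t 1 <= G
    would put h t s below - s^2; the supremum condition provides such a function.  By
    convexity and h t 0 <= 0 the condition h t s >= - s^2 persists when s grows, so
    these index sets generate a filter on K.  By upper semicontinuity a cluster
    point t satisfies h t s >= - s^2 for all small s; letting s tend to 0 in the
    convexity inequality improves this to h t s >= 0, and then to h t 0 = 0. *)
Lemma active_ray {R : realType} {T : topologicalType} (h : T -> R -> R)
    (K : set T) (G eps : R) :
    0 < eps -> compact K ->
    (forall t, - eps < h t 0 -> K t) ->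
    (forall t a l, 0 <= a <= 1 -> 0 <= l <= 1 ->
      h t (l * a) <= l * h t a + (1 - l) * h t 0) ->
    (forall t, h t 0 <= 0) -> (forall t, h t 1 <= G) ->
    (forall s a, 0 <= s <= 1 -> 0 < a -> exists t, - a < h t s) ->
    (forall s a t, 0 <= s <= 1 -> K t -> h t s < a ->
      \forall t' \near within K (nbhs t), h t' s < a) ->
  exists2 t, h t 0 = 0 & forall s, 0 <= s <= 1 -> 0 <= h t s.
Proof.
move=> eps0 Kcpt hK convh h0 hG suph usch.
(* for s <= s0 one has s G - (1 - s) eps <= - s^2 *)
pose s0 := eps / (`|G| + eps + 1).
have den0 : 0 < `|G| + eps + 1 by have := normr_ge0 G; lra.
have s0_gt0 : 0 < s0 by rewrite divr_gt0.
have s0_lt1 : s0 < 1 by rewrite ltr_pdivrMr//; have := normr_ge0 G; lra.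
have s0E : s0 * (`|G| + eps + 1) = eps by rewrite divfK ?gt_eqF.
have hs_le t s : 0 <= s <= 1 -> h t s <= s * G + (1 - s) * h t 0.
  move=> s01; have := convh t 1 s; rewrite mulr1 ler01 lexx => /(_ isT s01).
  move/le_trans; apply; rewrite lerD2r ler_wpM2l//.
  by case/andP: s01.
pose F s := [set t | K t /\ - (s * s) <= h t s].
have F_sub s s' : 0 < s -> s <= s' -> s' <= 1 -> F s `<=` F s'.
  move=> s_gt0 ss' s'1 t [Kt hts]; split => //.
  have s'_gt0 := lt_le_trans s_gt0 ss'.
  have := convh t s' (s / s').
  rewrite divfK ?gt_eqF// ltW//= s'1 divr_ge0 ?(ltW s_gt0) ?(ltW s'_gt0)//=.
  rewrite ler_pdivrMr// mul1r ss' => /(_ isT isT) hle.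
  have q1 : (1 - s / s') * h t 0 <= 0.
    by rewrite mulr_ge0_le0// subr_ge0 ler_pdivrMr// mul1r.
  rewrite leNgt; apply/negP => hlt.
  have : s / s' * h t s' < - (s * s').
    have -> : s * s' = s / s' * (s' * s') by rewrite mulrA divfK ?gt_eqF.
    by rewrite -mulrN ltr_pM2l ?divr_gt0.
  have : s * s <= s * s' by rewrite ler_pM2l.
  lra.
have F_neq0 s : 0 < s <= s0 -> F s !=set0.
  move=> /andP[s_gt0 ss0].
  have [||t ht] := suph s (s * s); [lra|exact: mulr_gt0|].
  exists t; split; last exact: ltW.
  apply: hK; rewrite ltNge; apply/negP => ht0.
  have : h t s <= s * G + (1 - s) * h t 0 by apply: hs_le; lra.
  have : (1 - s) * h t 0 <= (1 - s) * - eps by apply: ler_wpM2l; lra.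
  have : s * G <= s * `|G| by rewrite ler_pM2l// ler_norm.
  have : s * s <= s by rewrite ger_pMr//; lra.
  have : s * (`|G| + eps + 1) <= eps by rewrite -[leRHS]s0E ler_pM2r.
  lra.
pose FF := filter_from [set s | 0 < s <= s0] F.
have FF_filter : ProperFilter FF.
  apply: filter_from_proper; last by move=> s /F_neq0.
  apply: filter_from_filter; first by exists s0; rewrite /= s0_gt0 lexx.
  move=> s s' /andP[s_gt0 ss0] /andP[s'_gt0 s's0].
  exists (Num.min s s'); first by rewrite /= lt_min s_gt0 s'_gt0 ge_min ss0.
  by move=> t Ft; split; move: Ft; apply: F_sub;
    rewrite ?lt_min ?s_gt0 ?s'_gt0 ?ge_min ?lexx ?orbT//; lra.
have FFK : FF K by exists s0; [rewrite /= s0_gt0 lexx|move=> t []].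
have [t [Kt clt]] := Kcpt FF FF_filter FFK.
have hts s : 0 < s <= s0 -> - (s * s) <= h t s.
  move=> s0s; rewrite leNgt; apply/negP => hts.
  have s01 : 0 <= s <= 1 by case/andP: s0s; lra.
  have /= := usch s _ t s01 Kt hts; rewrite /prop_near1 /within/= => near_t.
  have [t' [[Kt' Ft'] /(_ Kt')]] := clt (F s) _ (ex_intro2 _ _ s s0s (fun _ => id)) near_t.
  by rewrite ltNge Ft'.
have hts_ge0 s : 0 < s <= 1 -> 0 <= h t s.
  move=> /andP[s_gt0 s1]; rewrite leNgt; apply/negP => hneg.
  (* l is so small that h t (l s) <= l (h t s) contradicts h t (l s) >= - l^2 *)
  pose l := Num.min s0 (- (h t s) / 2).
  have l_gt0 : 0 < l by rewrite lt_min s0_gt0; lra.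
  have ls0 : l <= s0 by rewrite ge_min lexx.
  have lh : l <= - (h t s) / 2 by rewrite ge_min lexx orbT.
  have l1 : l <= 1 by lra.
  have lss : l * s <= s0.
    by apply: le_trans ls0; rewrite ger_pMr.
  have := hts (l * s); rewrite mulr_gt0//= lss => /(_ isT).
  have := convh t s l; rewrite (ltW s_gt0) s1 (ltW l_gt0) l1 => /(_ isT isT).
  have : (1 - l) * h t 0 <= 0 by rewrite mulr_ge0_le0// subr_ge0.
  have : l * s * (l * s) <= l * l.
    by rewrite ler_pM ?mulr_ge0 ?(ltW l_gt0) ?(ltW s_gt0)// ger_pMr.
  have : l * l <= l * (- (h t s) / 2) by rewrite ler_pM2l.
  have : l * h t s < 0 by rewrite pmulr_rlt0.
  lra.
have ht0 : h t 0 = 0.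
  apply/le_anti; rewrite h0/= leNgt; apply/negP => hneg.
  pose l := Num.min (1 / 2) (- (h t 0) / (`|G| + 1) / 4).
  have G1 : 0 < `|G| + 1 by have := normr_ge0 G; lra.
  have l_gt0 : 0 < l.
    rewrite lt_min; apply/andP; split; first lra.
    by rewrite !divr_gt0//; lra.
  have l2 : l <= 1 / 2 by rewrite ge_min lexx.
  have lG : l * (`|G| + 1) <= - h t 0 / 4.
    by rewrite -ler_pdivlMr// mulrAC ge_min lexx orbT.
  have l01 : 0 < l <= 1 by lra.
  have : h t l <= l * G + (1 - l) * h t 0 by apply: hs_le; lra.
  have := hts_ge0 l l01.
  have : l * G <= l * `|G| by rewrite ler_pM2l// ler_norm.
  have : (1 - l) * h t 0 <= 1 / 2 * h t 0 by rewrite ler_nM2r//; lra.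
  lra.
exists t => // s /andP[]; rewrite le_eqVlt => /orP[/eqP <- _|s_gt0 s1].
  by rewrite ht0.
by apply: hts_ge0; rewrite s_gt0.
Qed.

(** Only a common finite majorant G of the g t is used: it makes g t w, hence u w,
    bounded above uniformly in t when v is approached by v + s w. *)
Lemma exists_active_subgradient_gt {R : realType} {X : tvsType R}
    (hX : hausdorff_space X) (D : set X) (n : nat) (e : 'I_n -> X)
    (T : topologicalType) (K : set T) (g : T -> X -> R) (G : X -> R) (eps : R) :
    segment_closed D ->
    D 0 -> D `<=` range (lincomb e) ->
    0 < eps -> compact K -> (forall t, - eps < g t 0 -> K t) ->
    (forall t, convex_fun_on D (g t)) -> (forall t, g t 0 <= 0) ->
    (forall t y, D y -> g t y <= G y) ->
    (forall y a, D y -> 0 < a -> exists t, - a < g t y) ->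
    (forall y a t, D y -> K t -> g t y < a ->
      \forall t' \near within K (nbhs t), g t' y < a) ->
  forall v delta, range (lincomb e) v -> 0 < delta ->
  exists2 u : dual X,
    exists2 t, g t 0 = 0 & forall y, D y -> u y <= g t y & - delta < u v.
Proof.
move=> convD D0 De eps0 Kcpt hK convg g0 gG supg uscg v delta ev delta0.
have [w Dw corew] := exists_core_point convD D0 De.
have DZ s y : 0 <= s <= 1 -> D y -> D (s *: y).
  by move=> s01 Dy; have := convD s y 0 s01 Dy D0; rewrite scaler0 addr0.
have at_core z : D z -> core_point D z -> exists2 u : dual X,
    exists2 t, g t 0 = 0 & forall y, D y -> u y <= g t y & 0 <= u z.
  move=> Dz corez.
  have [||||s a s01 a0|s a t s01 Kt|t gt0 gtz] :=
    @active_ray R T (fun t s => g t (s *: z)) K (G z) eps eps0 Kcpt.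
  - by move=> t; rewrite scale0r; exact: hK.
  - move=> t a l a01 l01; rewrite scale0r -scalerA.
    have := convg t l _ _ l01 (DZ _ _ a01 Dz) D0.
    by rewrite scaler0 addr0.
  - by move=> t; rewrite scale0r.
  - by move=> t; rewrite scale1r; exact: gG.
  - by apply: supg => //; exact: DZ.
  - by apply: uscg => //; exact: DZ.
  rewrite scale0r in gt0.
  have [u ug uz] := subgradient_at_core_point hX convD D0 De (convg t) gt0 Dz corez gtz.
  by exists u => //; exists t.
have Cw := subset_conical Dw.
have [vwC|] := pselect (forall s, 0 < s -> conical D (v + s *: w)).
  (* s u w <= s |G w| < delta *)
  pose s := delta / (`|G w| + 1) / 2.
  have G1 : 0 < `|G w| + 1 by have := normr_ge0 (G w); lra.
  have s_gt0 : 0 < s by rewrite !divr_gt0.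
  have [k [z [k0 Dz vswE]]] := vwC _ s_gt0.
  have zE : z = k^-1 *: (v + s *: w).
    by rewrite vswE scalerA mulVf ?scale1r// gt_eqF.
  have corez : core_point D z.
    move=> y Dy; have [r r0 Crwy] := corew y Dy.
    (* v + s w is the sum of a point v + (s / 2) w of the cone and of a multiple
       of the core point w *)
    have s2 : 0 < s / 2 by rewrite divr_gt0.
    exists (r / (s / 2) * k).
      by rewrite !mulr_ge0 ?invr_ge0 ?(ltW s2) ?(ltW k0).
    rewrite zE scalerA mulfK ?gt_eqF//.
    have -> : v + s *: w = v + (s / 2) *: w + (s / 2) *: w.
      by rewrite -addrA -scalerDl; congr (_ + _ *: _); lra.
    rewrite scalerDr [_ *: (s / 2 *: w)]scalerA divfK ?gt_eqF// -addrA.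
    apply: conicalD => //; apply: conicalZ => //; last exact: vwC.
    by rewrite mulr_ge0 ?invr_ge0// ltW.
  have [u [t gt0 ug] uz] := at_core z Dz corez.
  exists u; first by exists t.
  have uvsw : 0 <= u v + s * u w.
    have -> : u v + s * u w = u (v + s *: w) by rewrite linearD linearZ.
    by rewrite vswE linearZ mulr_ge0// ltW.
  have uwG : u w <= `|G w|.
    by apply: le_trans (ug _ Dw) _; apply: le_trans (gG _ _ Dw) _; exact: ler_norm.
  have : s * u w <= s * `|G w| by rewrite ler_pM2l.
  have : s * (`|G w| + 1) = delta / 2 by rewrite /s mulrAC divfK ?gt_eqF.
  by lra.
move=> /existsNP[s /not_implyP[s0 nCvsw]].
have [phi phiD phiv] := functional_negative_on_cone hX convD D0 De Dw corew ev s0 nCvsw.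
have [u [t gt0 ug] _] := at_core w Dw corew.
pose k := `|u v| / phi v.
have k0 : 0 <= k by rewrite divr_ge0// ltW.
exists (k *: phi + u).
  exists t => // y Dy; rewrite dualE.
  have := ug y Dy; have : k * phi y <= 0 by rewrite mulr_ge0_le0// phiD.
  by lra.
rewrite dualE divfK ?gt_eqF//.
by have := ler_norm (- u v); rewrite normrN; lra.
Qed.

(** * Approximation and separation in the weak* topology *)

Section weak_star.
Context {R : realType} {X : tvsType R}.
Implicit Types (C : set (dual X)) (u : dual X).

Lemma dual_eval_continuous (y : X) : continuous (fun u : dual X => (u y : R^o)).
Proof.
move=> u.
have cvg_u : {ptws, (@dual_val R X) @ nbhs u --> (u : X -> R^o)}.
  exact: (@initial_continuous _ _ (@dual_val R X : dual X -> {ptws X -> R^o})).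
by move/pointwise_cvgP : cvg_u => /(_ y).
Qed.

(** The functionals of C that are e-close to xs on a finite list of points form a
    filter base converging pointwise to xs. *)
Lemma dual_closed_approx C (xs : dual X) : closed C ->
    (forall n (y : 'I_n -> X) (e : R), 0 < e ->
      exists2 u, C u & forall i, `|u (y i) - xs (y i)| < e) ->
  C xs.
Proof.
move=> clC approx.
pose B (p : seq X * R) := [set u | C u /\ forall y, y \in p.1 -> `|u y - xs y| < p.2].
pose F := filter_from [set p : seq X * R | 0 < p.2] B.
have FF : ProperFilter F.
  apply: filter_from_proper => [|[s e] /= e0].
    apply: filter_from_filter; first by exists ([::], 1) => /=.
    move=> [s e] [s' e'] /= e0 e0'; exists (s ++ s', Num.min e e').
      by rewrite /= lt_min e0.
    move=> u [Cu us]; split; split=> // y /= ys; have := us y; rewrite /= mem_cat ys ?orbT.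
      by move=> /(_ isT); rewrite lt_min => /andP[].
    by move=> /(_ isT); rewrite lt_min => /andP[].
  have [u Cu us] := approx _ (fun i => tnth (in_tuple s) i) e e0.
  exists u; split => // y /= /(nthP 0)[i si <-].
  by have := us (Ordinal si); rewrite (tnth_nth 0).
have Fxs : F --> xs.
  have ptws_cvg : {ptws, (@dual_val R X) @ F --> (xs : X -> R^o)}.
    apply/pointwise_cvgP => y; apply/cvgrPdist_lt => e e0.
    exists ([:: y], e) => // u [Cu /= uy].
    by rewrite distrC; apply: uy; rewrite inE.
  move=> A [_ [[V oV <-] Vxs VA]].
  have : nbhs (xs : {ptws X -> R^o}) V by exact: open_nbhs_nbhs.
  move=> /ptws_cvg FV; exact: (filterS VA FV).
have FC : F C by exists ([::], 1) => //= u [].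
by apply: clC => U /Fxs FU; exact: filter_ex (filterI FC FU).
Qed.

End weak_star.

(** The hypothesis says that K avoids the open ball of radius eps of the sup norm.
    The constraints phi <= 1 on the unit ball and phi >= eps on K are then
    consistent. *)
Lemma separate_from_origin {R : realType} n (K : set 'rV[R]_n) (eps : R) :
    segment_closed K ->
    (forall k, K k -> exists i, eps <= `|k 0 i|) ->
  exists c : 'rV[R]_n, forall k, K k -> eps <= \sum_i c 0 i * k 0 i.
Proof.
move=> convK Keps; have [->|/set0P[k0 Kk0]] := eqVneq K set0; first by exists 0.
pose S := [set p : 'rV[R]_n * R | exists (l r : R) (b k : 'rV[R]_n), [/\ 0 <= l, K k,
  (forall i, `|b 0 i| <= r), p.1 = b - l *: k & r - l * eps <= p.2]].
have coneS : epi_cone S.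
  split=> [p q|k p k_gt0|a].
  - move=> [l [r [b [k [l0 Kk br p1 p2]]]]] [l' [r' [b' [k' [l0' Kk' br' q1 q2]]]]].
    have [m [m01 lm lm']] := convex_weight l0 l0'.
    exists (l + l'), (r + r'), (b + b'), (m *: k + (1 - m) *: k'); split.
    + exact: addr_ge0.
    + exact: convK.
    + by move=> i; rewrite mxE (le_trans (ler_normD _ _))// lerD.
    + by rewrite scalerDr !scalerA lm lm' /= p1 q1 opprD addrACA.
    + by rewrite /=; lra.
  - move=> [l [r [b [k' [l0 Kk br p1 p2]]]]].
    exists (k * l), (k * r), (k *: b), k'; split => //.
    + by rewrite mulr_ge0// ltW.
    + by move=> i; rewrite mxE normrM gtr0_norm// ler_pM2l.
    + by rewrite /= p1 scalerBr scalerA.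
    + by rewrite /= -mulrA -mulrBr ler_pM2l.
  - move=> [l [r [b [k [l0 Kk br /= /esym/eqP]]]]]; rewrite subr_eq0 => /eqP blk.
    apply: le_trans; rewrite subr_ge0; have [i ki] := Keps k Kk.
    apply: le_trans (br i); rewrite blk mxE normrM ger0_norm//.
    exact: ler_wpM2l.
have domS b : exists a, S (b, a).
  exists (\sum_i `|b 0 i|), 0, (\sum_i `|b 0 i|), b, k0; split => //=.
  - move=> i; rewrite (bigD1 i)//= lerDl; exact: sumr_ge0.
  - by rewrite scale0r subr0.
  - by rewrite mul0r subr0.
have [phi phiS] := hahn_banach_cone coneS domS.
exists (\row_i phi (delta_mx 0 i)) => k Kk.
rewrite [leRHS](_ : _ = phi k); last first.
  by rewrite linear_row_lincomb; apply: eq_bigr => i _; rewrite mxE mulrC.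
rewrite -lerN2 -linearN; apply: phiS; exists 1, 0, 0, k; split => //=.
- by move=> i; rewrite mxE normr0.
- by rewrite scale1r sub0r.
- by rewrite mul1r sub0r.
Qed.

(** * The supremum function *)

Section supremum_facts.
Context {R : realType} {X : tvsType R} {T : topologicalType}.
Context (f : T -> X -> \bar R).
Context (f_proper : forall t, proper_efun (f t))
  (f_convex : forall t, convex_efun (f t)).
Local Notation F := (sup_efun f).

Lemma le_sup_efun t y : (f t y <= F y)%E.
Proof. by apply: ereal_sup_ubound; exists t. Qed.

Lemma fin_num_effdom_sup t y : effdom F y -> f t y \is a fin_num.
Proof.
move=> Fy; rewrite fin_numE (f_proper t).2 -ltey/=.
exact: le_lt_trans (le_sup_efun t y) Fy.
Qed.

Lemma fin_num_sup (t : T) y : effdom F y -> F y \is a fin_num.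
Proof.
move=> Fy; rewrite fin_numE -ltey Fy andbT -ltNye.
by apply: lt_le_trans (le_sup_efun t y); rewrite ltNye (f_proper t).2.
Qed.

(** On dom F all the values are finite; convexity is stated there with real
    coefficients in [0, 1], the end points included. *)
Lemma fine_convex t (l : R) y z : 0 <= l <= 1 -> effdom F y -> effdom F z ->
  (f t (l *: y + (1 - l) *: z)%R <=
    (l * fine (f t y) + (1 - l) * fine (f t z))%R%:E)%E.
Proof.
move=> /andP[l0 l1] Fy Fz.
have fy := fineK (fin_num_effdom_sup t Fy).
have fz := fineK (fin_num_effdom_sup t Fz).
move: l0; rewrite le_eqVlt => /orP[/eqP <-|l0].
  by rewrite scale0r add0r subr0 scale1r mul0r add0r mul1r fz.
move: l1; rewrite le_eqVlt => /orP[/eqP ->|l1].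
  by rewrite subrr scale0r addr0 scale1r mul0r addr0 mul1r fy.
have := @f_convex t y z l; rewrite l0 l1 => /(_ isT).
by rewrite -{1}fy -{1}fz -!EFinM -dEFinD.
Qed.

Lemma effdom_sup_convex (l : R) y z : 0 <= l <= 1 -> effdom F y -> effdom F z ->
  effdom F (l *: y + (1 - l) *: z).
Proof.
move=> l01 Fy Fz.
have [T0|/set0P[t0 _]] := eqVneq [set: T] set0.
  by rewrite /effdom/= /sup_efun T0 image_set0 ereal_sup0.
apply: (@le_lt_trans _ _ (l * fine (F y) + (1 - l) * fine (F z))%:E); last first.
  exact: ltry.
apply: ge_ereal_sup => _ [t _ <-].
apply: le_trans (fine_convex t l01 Fy Fz) _.
have /andP[l0 l1] := l01; rewrite lee_fin.
by rewrite lerD// ler_wpM2l ?subr_ge0// fine_le ?le_sup_efun ?(fin_num_sup t)//;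
  exact: fin_num_effdom_sup.
Qed.

End supremum_facts.

Lemma finite_dim_subspace_span2 {R : realType} {X : tvsType R} (x y : X) :
  exists L : set X, [/\ finite_dim_subspace L, L x & L y].
Proof.
pose e (i : 'I_2) := if i == ord0 then x else y.
exists (range (fun c : 'I_2 -> R => \sum_i c i *: e i)); split.
- by exists 2%N, e.
- exists (fun i => (i == ord0)%:R) => //.
  by rewrite !big_ord_recl big_ord0 /e/= scale1r scale0r !addr0.
- exists (fun i => (i != ord0)%:R) => //.
  by rewrite !big_ord_recl big_ord0 /e/= scale1r scale0r addr0 add0r.
Qed.

Lemma closed_convex_hull_sub {R : realType} {X : tvsType R} (A C : set (dual X)) :
  closed C -> convex_set C -> A `<=` C -> closed_convex_hull A `<=` C.
Proof. by move=> clC convC AC u; apply. Qed.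

Lemma subdifferential_add_indicator {R : realType} {X : tvsType R}
    (phi : X -> \bar R) (A : set X) (x : X) (u : dual X) :
    (forall y, phi y != -oo%E) -> A x ->
  subdifferential (fun y => (phi y + indicator_efun A y)%dE) x u <->
  phi x \is a fin_num /\ forall y, A y -> ((u (y - x)%R)%:E <= phi y - phi x)%E.
Proof.
move=> phiNy Ax; rewrite /subdifferential /indicator_efun /= mem_set// dadde0.
split=> -[phix h]; split=> // y.
  by move=> Ay; have := h y; rewrite mem_set// dadde0.
have [yA|yA] := boolP (y \in A).
  by rewrite dadde0; apply: h; rewrite inE in yA.
move: (phiNy y) phix; case: (phi y) => [r| |]//= _;
  by case: (phi x) => //= s _; rewrite leey.
Qed.

(** Finiteness of F x is built into the closed convex set, so that an empty set of
    subgradients is covered without a separate argument. *)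
Lemma sub_closed_convex_hull_active {R : realType} {X : tvsType R}
    {T : topologicalType} (f : T -> X -> \bar R)
    (f_proper : forall t, proper_efun (f t)) (x : X) :
  \bigcap_(L in [set L : set X | finite_dim_subspace L /\ L x])
    closed_convex_hull (\bigcup_(t in active f x)
      subdifferential
        (fun y => (f t y + indicator_efun (L `&` effdom (sup_efun f)) y)%dE) x)
  `<=` subdifferential (sup_efun f) x.
Proof.
set F := sup_efun f => xs hxs.
suff hy y : F x \is a fin_num /\ (effdom F y -> xs (y - x) <= fine (F y) - fine (F x)).
  have [Fx _] := hy x; split => // y; have [_ hFy] := hy y.
  have [Fy|] := pselect (effdom F y); last first.
    move/negP; rewrite /= -leNgt leye_eq => /eqP ->.
    by case: (F x) Fx => //= r _; rewrite leey.
  have [t _] : [set: T] !=set0.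
    apply/set0P/negP => /eqP T0.
    by move: Fx; rewrite /F /sup_efun T0 image_set0 ereal_sup0.
  have Fy_fin : F y \is a fin_num by exact: fin_num_sup t _ _.
  by rewrite -(fineK Fx) -(fineK Fy_fin) -EFinB lee_fin; exact: hFy.
have [L [Lfin Lx Ly]] := finite_dim_subspace_span2 x y.
pose C1 : set (dual X) := [set _ | F x \is a fin_num].
pose C2 : set (dual X) :=
  [set u | effdom F y -> u (y - x) <= fine (F y) - fine (F x)].
apply: (@closed_convex_hull_sub _ _ _ (C1 `&` C2) _ _ _ _ (hxs L (conj Lfin Lx))).
- apply: closedI.
    have [Fx|/negP Fx] := boolP (F x \is a fin_num).
      by rewrite (_ : C1 = setT)//; apply/seteqP; split.
    rewrite (_ : C1 = set0); last by apply/seteqP; split.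
    exact: closed0.
  have [Fy|nFy] := pselect (effdom F y); last first.
    by rewrite (_ : C2 = setT)//; apply/seteqP; split => // u _ /nFy.
  rewrite (_ : C2 = (fun u : dual X => (u (y - x) : R^o)) @^-1`
      [set a | a <= fine (F y) - fine (F x)]); last first.
    by apply/seteqP; split => u h; [exact: h Fy|move=> _; exact: h].
  apply: preimage_closed; last exact: closed_le.
  by move=> u _; exact: dual_eval_continuous.
- move=> u u' l; rewrite !inE => -[Fx hu] [_ hu']; split => // Fy.
  have /= l0 : 0 <= l%:num by [].
  have l1 : l%:num <= 1 by [].
  rewrite [leLHS](_ : _ = l%:num * u (y - x) + (1 - l%:num) * u' (y - x)); last by [].
  have := ler_wpM2l l0 (hu Fy).
  have : (1 - l%:num) * u' (y - x) <= (1 - l%:num) * (fine (F y) - fine (F x)).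
    by apply: ler_wpM2l; [rewrite subr_ge0|exact: hu'].
  by lra.
- move=> u [t ft /= uft].
  have [Fx|nFx] := pselect (effdom F x); last first.
    case: uft => + _; rewrite /indicator_efun memNset; last by case.
    by case: (f t x).
  have [ftx ftu] := (subdifferential_add_indicator u (f_proper t).2 (conj Lx Fx)).1 uft.
  split=> [|Fy]; first exact: (fin_num_sup f_proper t Fx).
  have := ftu y (conj Ly Fy); rewrite ft.
  have Fxf := fin_num_sup f_proper t Fx; have Fyf := fin_num_sup f_proper t Fy.
  move=> /le_trans/(_ (leeB (le_sup_efun f t y) (lexx _))).
  by rewrite -(fineK Fxf) -(fineK Fyf) -EFinB lee_fin.
Qed.

(** * The subdifferential of the supremum *)

Definition cat_family {X : Type} n m (e : 'I_n -> X) (d : 'I_m -> X) : 'I_(n + m) -> X :=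
  fun i => match fintype.split i with inl j => e j | inr j => d j end.

Lemma lincomb_cat {R : realType} {X : lmodType R} n m (e : 'I_n -> X)
    (d : 'I_m -> X) (b : 'rV[R]_n) (c : 'rV[R]_m) :
  lincomb (cat_family e d) (row_mx b c) = lincomb e b + lincomb d c.
Proof.
rewrite /lincomb big_split_ord/=; congr (_ + _); apply: eq_bigr => i _.
  by rewrite row_mxEl /cat_family -[lshift _ _]/(unsplit (inl i)) unsplitK.
by rewrite row_mxEr /cat_family -[rshift _ _]/(unsplit (inr i)) unsplitK.
Qed.

(** [exists_active_subgradient_gt] translated back: the functions
    f t (x + d) - F x - xs d of d are <= 0 at d = 0, and their supremum is >= 0
    because xs is a subgradient of F. *)
Lemma subdifferential_sup_approx {R : realType} {X : tvsType R}
    (hX : hausdorff_space X) {T : topologicalType} (f : T -> X -> \bar R)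
    (f_proper : forall t, proper_efun (f t))
    (f_convex : forall t, convex_efun (f t))
    (x : X) (eps0 : R) (eps0_gt0 : 0 < eps0)
    (hcompact : compact (eps_active f x eps0))
    (husc : forall z, effdom (sup_efun f) z ->
       upper_semicontinuous_on (eps_active f x eps0) (f ^~ z))
    (xs : dual X) (n : nat) (e : 'I_n -> X) (v : X) (delta : R) :
  subdifferential (sup_efun f) x xs -> range (lincomb e) v -> 0 < delta ->
  exists2 u : dual X, - delta < u v & exists2 t, active f x t &
    forall y, range (lincomb e) (y - x) -> effdom (sup_efun f) y ->
      (((u + xs)%R (y - x)%R)%:E <= f t y - f t x)%E.
Proof.
set F := sup_efun f => -[Fx hxs] ev delta0.
have Fx_dom : effdom F x by rewrite /effdom/= ltey; case/fin_numP: Fx.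
pose D := [set d | range (lincomb e) d /\ effdom F (x + d)].
have finf t d : D d -> f t (x + d) = (fine (f t (x + d)))%:E.
  by move=> [_ Fd]; rewrite fineK// (fin_num_effdom_sup f_proper).
pose g t d := fine (f t (x + d)) - fine (F x) - xs d.
have D0 : D 0 by split; [exists 0; rewrite ?linear0|rewrite addr0].
have xD (l : R) y z : x + (l *: y + (1 - l) *: z) = l *: (x + y) + (1 - l) *: (x + z).
  by rewrite !scalerDr addrACA -scalerDl [l + _]addrC subrK scale1r.
have convD (l : R) y z : 0 <= l <= 1 -> D y -> D z -> D (l *: y + (1 - l) *: z).
  move=> l01 [[b _ <-] Fy] [[c _ <-] Fz]; split.
    by exists (l *: b + (1 - l) *: c); rewrite // linearD !linearZ.
  by rewrite xD; exact: (effdom_sup_convex f_proper f_convex).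
have g0 t : g t 0 = fine (f t x) - fine (F x) by rewrite /g addr0 linear0 subr0.
have ftx t : f t x = (fine (f t x))%:E by have := finf t _ D0; rewrite addr0.
have [u [t gt0 ug] uv] : exists2 u : dual X,
    exists2 t, g t 0 = 0 & forall y, D y -> u y <= g t y & - delta < u v.
  apply: (@exists_active_subgradient_gt R X hX D n e T (eps_active f x eps0) g
    (fun y => fine (F (x + y)) - fine (F x) - xs y) eps0) => //.
  - by move=> y [].
  - move=> t; rewrite g0 /eps_active/= -/F ftx -(fineK Fx) -EFinB lee_fin; lra.
  - move=> t l y z l01 Dy Dz; rewrite /g.
    have -> : xs (l *: y + (1 - l) *: z) = l * xs y + (1 - l) * xs z.
      by rewrite linearD !linearZ.
    have := fine_convex f_proper f_convex t l01 Dy.2 Dz.2.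
    rewrite -xD finf ?lee_fin; last exact: convD.
    by lra.
  - move=> t; rewrite g0 subr_le0 fine_le//; last exact: le_sup_efun.
    by rewrite ftx.
  - move=> t y Dy; rewrite /g !lerB// fine_le//.
    + by rewrite (finf t y Dy).
    + exact: (fin_num_sup f_proper t Dy.2).
    + exact: le_sup_efun.
  - move=> y a Dy a0.
    have [t0 _] : [set: T] !=set0.
      apply/set0P/negP => /eqP T0.
      by move: Fx; rewrite /F /sup_efun T0 image_set0 ereal_sup0.
    have FyK : (fine (F (x + y)%R))%:E = F (x + y) := fineK (fin_num_sup f_proper t0 Dy.2).
    have : ((fine (F (x + y)%R) - a)%:E < F (x + y)%R)%E.
      by rewrite -[ltRHS]FyK lte_fin; lra.
    move=> /ereal_sup_gt[_ [t _ <-]]; rewrite (finf t y Dy) lte_fin => fty.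
    exists t; rewrite /g.
    have := hxs (x + y); rewrite addrAC subrr add0r -(fineK Fx) -FyK -EFinB lee_fin.
    by lra.
  - move=> y a t Dy Kt gta.
    have := @husc _ Dy.2 t (a + fine (F x) + xs y) Kt.
    have gta' : fine (f t (x + y)) < a + fine (F x) + xs y by rewrite /g in gta; lra.
    rewrite (finf t y Dy) lte_fin => /(_ gta').
    by apply: filterS => t'; rewrite (finf t' y Dy) lte_fin /g; lra.
exists u => //; exists t.
  by rewrite /active/= -/F ftx -(fineK Fx); congr EFin; move: gt0; rewrite g0; lra.
move=> y ey Fy.
have Dy : D (y - x) by split; rewrite // addrC subrK.
have := ug _ Dy; rewrite /g ftx.
have := finf t _ Dy; rewrite addrC subrK => ->.
move: gt0; rewrite g0 -EFinB lee_fin.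
rewrite -[(u + xs) _]/(u (y - x) + xs (y - x)).
by lra.
Qed.

Theorem theorem3 (R : realType) (X : tvsType R) (hX : hausdorff_space X)
    (T : topologicalType) (f : T -> X -> \bar R)
    (f_proper : forall t, proper_efun (f t))
    (f_lsc : forall t, lower_semicontinuous (f t))
    (f_convex : forall t, convex_efun (f t))
    (x : X) (eps0 : R) (eps0_gt0 : 0 < eps0)
    (hcompact : compact (eps_active f x eps0))
    (husc : forall z, effdom (sup_efun f) z ->
       upper_semicontinuous_on (eps_active f x eps0) (f ^~ z)) :
  subdifferential (sup_efun f) x =
  \bigcap_(L in [set L : set X | finite_dim_subspace L /\ L x])
    closed_convex_hull (\bigcup_(t in active f x)
      subdifferential
        (fun y => (f t y + indicator_efun (L `&` effdom (sup_efun f)) y)%dE) x).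
Proof.
apply/seteqP; split; last exact: sub_closed_convex_hull_active.
set F := sup_efun f => xs dxs L [[n [e LE]] Lx] C [[clC convC] AC].
have Fx_dom : effdom F x by have [Fx _] := dxs; rewrite /effdom/= ltey; case/fin_numP: Fx.
have approx m (y : 'I_m -> X) v delta : range (lincomb y) v -> 0 < delta ->
    exists2 u : dual X, C (u + xs) & - delta < u v.
  move=> yv delta0.
  have ev : range (lincomb (cat_family e y)) v.
    by case: yv => c _ <-; exists (row_mx 0 c); rewrite // lincomb_cat linear0 add0r.
  have [u uv [t tx ut]] := subdifferential_sup_approx hX f_proper f_convex
    eps0_gt0 hcompact husc dxs ev delta0.
  exists u => //; apply: AC; exists t => //.
  apply: (subdifferential_add_indicator (u + xs) (f_proper t).2 (conj Lx Fx_dom)).2.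
  split=> [|z [Lz Fz]]; first by rewrite tx; case: dxs.
  apply: ut => //; move: Lz Lx; rewrite LE => -[b _ <-] [c _ <-].
  exists (row_mx (\row_i (b i - c i)) 0) => //.
  rewrite lincomb_cat linear0 addr0 /lincomb -sumrB.
  by apply: eq_bigr => i _; rewrite mxE scalerBl.
(* the span of L and of the points y i on which xs is to be approximated is the
   subspace used by approx *)
apply: dual_closed_approx => // m y eps eps_gt0.
apply: contrapT => napprox.
pose K := [set (\row_i (u (y i) - xs (y i)) : 'rV[R]_m) | u in C].
have [l k k' l01|_ [u Cu <-]|c cK] := @separate_from_origin R m K eps.
- move=> [u Cu <-] [u' Cu' <-]; exists (l *: u + (1 - l) *: u').
    exact: (convex_set_segment_closed convC).
  apply/rowP => i; rewrite !mxE.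
  rewrite -[(l *: u + _) _]/(l * u (y i) + (1 - l) * u' (y i)).
  by rewrite /GRing.scale/=; ring.
- apply: contrapT => nge; apply: napprox; exists u => // i.
  by rewrite ltNge; apply/negP => ge; apply: nge; exists i; rewrite mxE.
(* separation bounds u - xs below by eps at the combination of the y i with
   coefficients c, whereas approx at its opposite yields a value < eps *)
- have [u Cu] := approx m y (lincomb y (- c)) eps (imageT _ _) eps_gt0.
  have := cK _ (imageP _ Cu); rewrite linearN linearN ltrN2 linear_sum.
  rewrite (eq_bigr (fun i => u (c 0 i *: y i))) => [|i _]; first by lra.
  rewrite linearZ/= mxE; congr (_ * _).
  exact: (addrK (xs (y i)) (u (y i))).
Qed.
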